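(* Let $\{J,E,g\}$ be a hypersymplectic structure on a Lie algebra $\mathfrak{g}$ and let $(\mathfrak{g},\mathfrak{g}_+,\mathfrak{g}_-)$ be the double Lie algebra associated to the complex product structure $\{J,E\}$. Then $\mathfrak{g}_+$ carries a flat torsion-free connection $\nabla^+$ and a compatible symplectic form $\omega_+$ (i.e. $\nabla^+\omega_+=0$), and similarly $\mathfrak{g}_-$ carries a flat torsion-free connection $\nabla^-$ and a compatible symplectic form $\omega_-$ (i.e. $\nabla^-\omega_-=0$). These symplectic forms are related by $\omega_+(x,y)=\omega_-(Jx,Jy)$ for $x,y\in\mathfrak{g}_+$.
   Context: All Lie algebras are finite-dimensional over $\mathbb{R}$. A complex structure on a Lie algebra $\mathfrak{g}$ is a linear endomorphism $J$ with $J^2=-\mathrm{Id}$ and $J[x,y]=[Jx,y]+[x,Jy]+J[Jx,Jy]$ for all $x,y$. A product structure is a linear endomorphism $E\neq\pm\mathrm{Id}$ with $E^2=\mathrm{Id}$ and $E[x,y]=[Ex,y]+[x,Ey]-E[Ex,Ey]$ for all $x,y$. A complex product structure is a pair $\{J,E\}$ of a complex structure and a product structure with $JE=-EJ$. Its associated double Lie algebra is $(\mathfrak g,\mathfrak g_+,\mathfrak g_-)$, where $\mathfrak g_\pm$ is the $(\pm1)$-eigenspace of $E$; $\mathfrak g_\pm$ are Lie subalgebras, $\mathfrak g=\mathfrak g_+\oplus\mathfrak g_-$ as vector spaces and $\mathfrak g_-=J\mathfrak g_+$. A metric on $\mathfrak g$ is a nondegenerate symmetric bilinear form $g$; it is compatible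 with $\{J,E\}$ if $g(Jx,Jy)=g(x,y)$ and $g(Ex,Ey)=-g(x,y)$ for all $x,y$. A 2-form $\omega$ on a Lie algebra is closed if $-\omega([x,y],z)+\omega([x,z],y)-\omega([y,z],x)=0$ for all $x,y,z$; a symplectic form is a nondegenerate closed 2-form. If $g$ is compatible with $\{J,E\}$ and the 2-forms $\omega_1(x,y)=g(Jx,y)$, $\omega_2(x,y)=g(Ex,y)$, $\omega_3(x,y)=g(JEx,y)$ are closed, $\{J,E,g\}$ is a hypersymplectic structure on $\mathfrak g$. A connection on a Lie algebra $\mathfrak h$ is a bilinear map $\nabla:\mathfrak h\times\mathfrak h\to\mathfrak h$; it is torsion-free if $\nabla_xy-\nabla_yx=[x,y]$ and flat if $\nabla_x\nabla_y-\nabla_y\nabla_x=\nabla_{[x,y]}$ for all $x,y$. For a 2-form $\omega$ on $\mathfrak h$, $\nabla\omega=0$ means $\omega(\nabla_xy,z)=\omega(\nabla_xz,y)$ for all $x,y,z\in\mathfrak h$. *)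

(* Defs.v *)
From HB Require Import structures.
From mathcomp Require Import all_boot all_order all_algebra.
From mathcomp Require Import reals.

Set Implicit Arguments.
Unset Strict Implicit.
Unset Printing Implicit Defensive.

Import Order.TTheory GRing.Theory Num.Theory.
Local Open Scope ring_scope.

HB.mixin Record Vector_isLie (K : fieldType) V of Vector K V := {
  lie : V -> V -> V;
  lie_bilinear : bilinear_for *:%R *:%R lie;
  liexx : forall x, lie x x = 0;
  lie_jacobi : forall x y z,
    lie x (lie y z) + lie y (lie z x) + lie z (lie x y) = 0
}.

#[short(type="lieAlgebra")]
HB.structure Definition LieAlgebra (K : fieldType) :=
  { V of Vector K V & Vector_isLie K V }.

HB.instance Definition _ (K : fieldType) (g : lieAlgebra K) :=
  bilinear_isBilinear.Build K g g g _ _ (@lie K g) (@lie_bilinear K g).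

Record lieSubalgebra (K : fieldType) (g : lieAlgebra K) := LieSubalgebra {
  lie_subspace :> {vspace g};
  lie_closed : {in lie_subspace &, forall x y, lie x y \in lie_subspace}
}.

Section SubalgebraIsLie.
Variables (K : fieldType) (g : lieAlgebra K) (h : lieSubalgebra g).

Definition sub_lie (x y : subvs_of h) : subvs_of h :=
  Subvs (lie_closed (subvsP x) (subvsP y)).

Fact sub_lie_bilinear : bilinear_for *:%R *:%R sub_lie.
Proof.
by split=> u a x y; apply/val_inj => /=; rewrite ?linearPl ?linearPr.
Qed.

Fact sub_liexx x : sub_lie x x = 0.
Proof. by apply/val_inj; rewrite /= liexx. Qed.

Fact sub_lie_jacobi x y z :
  sub_lie x (sub_lie y z) + sub_lie y (sub_lie z x)
    + sub_lie z (sub_lie x y) = 0.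
Proof. by apply/val_inj; rewrite /= lie_jacobi. Qed.

HB.instance Definition _ :=
  Vector_isLie.Build K (subvs_of h) sub_lie_bilinear sub_liexx sub_lie_jacobi.

End SubalgebraIsLie.

Definition algebra_of (K : fieldType) (g : lieAlgebra K)
  (h : lieSubalgebra g) : lieAlgebra K := subvs_of h.

Notation connection h := {bilinear h -> h -> h}.

Section Forms.
Variables (K : fieldType) (h : lieAlgebra K).

Definition torsion_free (nabla : connection h) :=
  forall x y, nabla x y - nabla y x = lie x y.

Definition flat (nabla : connection h) :=
  forall x y z,
    nabla x (nabla y z) - nabla y (nabla x z) = nabla (lie x y) z.

Definition closed_form (w : h -> h -> K) :=
  forall x y z, - w (lie x y) z + w (lie x z) y - w (lie y z) x = 0.

(* A 2-form is an inhabitant of {skew_symmetric h}; it is alternating as soon as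
   2 is invertible, which is the case over the reals. *)
Definition symplectic (w : {skew_symmetric h}) :=
  nondegenerate w /\ closed_form w.

Definition parallel (nabla : connection h) (w : {skew_symmetric h}) :=
  forall x y z, w (nabla x y) z = w (nabla x z) y.

End Forms.

Record doubleLieAlgebra (K : fieldType) (g : lieAlgebra K) :=
  DoubleLieAlgebra {
    double_plus : lieSubalgebra g;
    double_minus : lieSubalgebra g;
    double_sum : (double_plus + double_minus = fullv)%VS;
    double_cap : (double_plus :&: double_minus = 0)%VS
  }.

Section ComplexProduct.
Variables (R : realType) (g : lieAlgebra R).

Record complexStructure := ComplexStructure {
  complex_map :> 'End(g);
  complex_sq : forall x, complex_map (complex_map x) = - x;
  complex_int : forall x y,
    complex_map (lie x y) =
      lie (complex_map x) y + lie x (complex_map y)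
      + complex_map (lie (complex_map x) (complex_map y))
}.

Record productStructure := ProductStructure {
  product_map :> 'End(g);
  product_neq1 : product_map <> \1%VF;
  product_neqN1 : product_map <> - \1%VF;
  product_sq : forall x, product_map (product_map x) = x;
  product_int : forall x y,
    product_map (lie x y) =
      lie (product_map x) y + lie x (product_map y)
      - product_map (lie (product_map x) (product_map y))
}.

Record complexProductStructure := ComplexProductStructure {
  cps_J : complexStructure;
  cps_E : productStructure;
  cps_anticomm : forall x, cps_J (cps_E x) = - cps_E (cps_J x)
}.

Lemma mem_leigenspace (f : 'End(g)) (a : R) x :
  (x \in passmx.leigenspace f a) = (f x == a *: x).
Proof.
by rewrite memv_ker add_lfunE opp_lfunE scale_lfunE id_lfunE subr_eq0.
Qed.

Fact eigenspace_lie_closed (E : productStructure) (a : R) : a * a = 1 ->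
  {in passmx.leigenspace E a &, forall x y, lie x y \in passmx.leigenspace E a}.
Proof.
move=> aa x y; rewrite !mem_leigenspace => /eqP Ex /eqP Ey.
have := product_int E x y.
rewrite Ex Ey !linearZl_LR !linearZr_LR /= scalerA aa scale1r => e.
have {}e : E (lie x y) *+ 2 = (a *: lie x y) *+ 2.
  by rewrite !mulr2n {1}e addrNK.
apply/eqP; move: e; rewrite -!scaler_nat; apply: scalerI.
by rewrite pnatr_eq0.
Qed.

Definition eigen_plus (E : productStructure) : lieSubalgebra g :=
  LieSubalgebra (@eigenspace_lie_closed E 1 (mulr1 1)).

Definition eigen_minus (E : productStructure) : lieSubalgebra g :=
  LieSubalgebra (@eigenspace_lie_closed E (-1) (etrans (mulrNN 1 1) (mulr1 1))).


Section AssociatedDouble.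
Variable P : complexProductStructure.
Notation J := (cps_J P).
Notation E := (cps_E P).

Fact mem_eigen_plus x : (x \in eigen_plus E) = (E x == x).
Proof. by rewrite mem_leigenspace scale1r. Qed.

Fact mem_eigen_minus x : (x \in eigen_minus E) = (E x == - x).
Proof. by rewrite mem_leigenspace scaleN1r. Qed.

Fact eigen_sum : (eigen_plus E + eigen_minus E = fullv)%VS.
Proof.
have two0 : (2 : R) != 0 by rewrite pnatr_eq0.
apply/vspaceP => x; rewrite memvf; apply/memv_addP.
exists (2^-1 *: (x + E x)).
  by rewrite mem_eigen_plus linearZ linearD /= product_sq addrC.
exists (2^-1 *: (x - E x)).
  by rewrite mem_eigen_minus linearZ linearB /= product_sq -scalerN opprB.
by rewrite -scalerDr addrACA subrr addr0 -mulr2n -scaler_nat scalerA mulVf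
  // scale1r.
Qed.

Fact eigen_cap : (eigen_plus E :&: eigen_minus E = 0)%VS.
Proof.
apply/vspaceP => x; rewrite memv_cap memv0.
rewrite (_ : (x \in _) = (E x == x)) ?mem_eigen_plus //.
rewrite (_ : (x \in _) = (E x == - x)) ?mem_eigen_minus //.
apply/andP/eqP => [[/eqP e1 /eqP]|->]; last by rewrite linear0 oppr0 eqxx.
rewrite e1 => /eqP; rewrite -addr_eq0 -mulr2n -scaler_nat scaler_eq0.
by rewrite pnatr_eq0 /= => /eqP.
Qed.

Definition associated_double : doubleLieAlgebra g :=
  DoubleLieAlgebra eigen_sum eigen_cap.

Fact cps_J_plus x :
  x \in double_plus associated_double -> J x \in double_minus associated_double.
Proof.
rewrite mem_eigen_plus mem_eigen_minus => /eqP Ex.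
by rewrite -eqr_oppLR -cps_anticomm Ex.
Qed.

(* J restricted to a map from the (+1)- to the (-1)-eigenspace of E *)
Definition J_plus (x : algebra_of (double_plus associated_double)) :
    algebra_of (double_minus associated_double) :=
  Subvs (cps_J_plus (subvsP x)).

End AssociatedDouble.

Record hypersymplecticStructure := HypersymplecticStructure {
  hs_cps :> complexProductStructure;
  hs_metric : {symmetric g};
  hs_nondegenerate : nondegenerate hs_metric;
  hs_compatJ : forall x y,
    hs_metric (cps_J hs_cps x) (cps_J hs_cps y) = hs_metric x y;
  hs_compatE : forall x y,
    hs_metric (cps_E hs_cps x) (cps_E hs_cps y) = - hs_metric x y;
  hs_closed1 : closed_form (fun x y => hs_metric (cps_J hs_cps x) y);
  hs_closed2 : closed_form (fun x y => hs_metric (cps_E hs_cps x) y);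
  hs_closed3 :
    closed_form (fun x y => hs_metric (cps_J hs_cps (cps_E hs_cps x)) y)
}.

End ComplexProduct.

(* Main.v *)
Require Import Defs.
From HB Require Import structures.
From mathcomp Require Import all_boot all_order all_algebra.
From mathcomp Require Import reals.
From mathcomp Require Import ring lra.

(** Since g (E x) (E y) = - g x y, both eigenspaces of E are totally isotropic
    for the metric, so the metric pairs them with each other; as J exchanges
    them, omega x y = g (J x) y restricts to a nondegenerate form on each.
    It is closed because the ambient omega_1 is, and J preserves it because J
    is an isometry.

    The connection is the one that the complex product structure induces. For a
    subalgebra h, the bracket makes g / h an h-module (the Bott connection).
    When h is an eigenspace of E, the other eigenspace J h is a copy of g / h,
    and J identifies it with h, so that nabla_x y = - J (pi [x, J y]), with pi
    the projection on J h along h.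
    - It is flat because it is a module structure ([induced_flat]).
    - Its torsion vanishes by the integrability of J: up to elements of h,
      [x, J y] + [J x, y] is J [x, y] ([induced_torsion_free]).
    - It preserves omega because of the closedness of omega_2
      ([induced_parallel]). Put A x y z = omega (nabla_x y) z and let
      B x y z = A x y z - A x z y be the defect of parallelism. Closedness on
      the triple (x, J y, z) reads B x y z = - B z x y; a cyclic permutation
      applied three times is the identity, whence B = - B = 0.

    Both eigenspaces are handled at once: the eigenvalue a is only required to
    satisfy a * a = 1, and the theorem takes a = 1 and a = -1. *)

Set Implicit Arguments.
Unset Strict Implicit.

Import GRing.Theory Num.Theory.
Local Open Scope ring_scope.

(** * Lie brackets *)

Section LieBracket.
Variables (K : fieldType) (g : lieAlgebra K).
Implicit Types x y z : g.

Lemma lieC x y : lie x y = - lie y x.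
Proof.
apply/eqP; rewrite -addr_eq0; have := liexx (x + y).
by rewrite linearDl !linearDr /= !liexx add0r addr0 => ->.
Qed.

Lemma lie_lie x y z : lie (lie x y) z = lie x (lie y z) - lie y (lie x z).
Proof.
rewrite lieC; apply/esym/eqP; rewrite -subr_eq0 opprK.
by rewrite (lieC x z) linearNr opprK lie_jacobi.
Qed.

End LieBracket.

(** * The connection induced on an eigenspace of the product structure *)

Section Eigenalgebra.
Variables (R : realType) (g : lieAlgebra R) (P : complexProductStructure g).
Notation J := (cps_J P).
Notation E := (cps_E P).
Implicit Types (a b : R) (w x y z : g).

Let two_neq0 : (2 : R) != 0. Proof. by rewrite pnatr_eq0. Qed.

Lemma eigenJ b x : E x = b *: x -> E (J x) = - b *: J x.
Proof.
by move=> Ex; rewrite -[E _]opprK -cps_anticomm Ex linearZ scaleNr.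
Qed.

Definition eigenalgebra a (aa : a * a = 1) : lieSubalgebra g :=
  LieSubalgebra (eigenspace_lie_closed (E := E) aa).

Lemma mem_eigenalgebra a (aa : a * a = 1) x :
  reflect (E x = a *: x) (x \in eigenalgebra aa).
Proof. by rewrite mem_leigenspace; apply: eqP. Qed.

Lemma eigen_lie a x y : a * a = 1 -> E x = a *: x -> E y = a *: y ->
  E (lie x y) = a *: lie x y.
Proof.
move=> aa Ex Ey; apply/(mem_eigenalgebra aa)/lie_closed.
  exact/(mem_eigenalgebra aa).
exact/(mem_eigenalgebra aa).
Qed.

Variables (a : R) (aa : a * a = 1).

(** The projection on the (-a)-eigenspace of E, along the a-eigenspace. *)
Definition opp_proj : 'End(g) := (2^-1 *: (\1 - a *: (E : 'End(g))))%VF.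

Lemma opp_projE w : opp_proj w = 2^-1 *: (w - a *: E w).
Proof. by rewrite !lfunE /= !lfunE /= !lfunE /= lfunE. Qed.

Lemma eigen_opp_proj w : E (opp_proj w) = - a *: opp_proj w.
Proof.
rewrite opp_projE linearZ linearB linearZ /= product_sq.
rewrite [RHS]scalerA [in RHS]mulrC -[RHS]scalerA [in RHS]scalerBr.
by rewrite scalerA mulNr aa scaleN1r opprK scaleNr addrC.
Qed.

Lemma opp_proj_id w : E w = - a *: w -> opp_proj w = w.
Proof.
move=> Ew; rewrite opp_projE Ew scalerA mulrN aa scaleN1r opprK.
by rewrite -mulr2n -scaler_nat scalerA mulVf ?scale1r.
Qed.

Lemma opp_proj_eq0 w : E w = a *: w -> opp_proj w = 0.
Proof. by move=> Ew; rewrite opp_projE Ew scalerA aa scale1r subrr scaler0. Qed.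

Lemma eigen_sub_opp_proj w : E (w - opp_proj w) = a *: (w - opp_proj w).
Proof.
have -> : w - opp_proj w = 2^-1 *: (w + a *: E w).
  apply: (scalerI two_neq0); rewrite opp_projE scalerBr !scalerA divff //.
  by rewrite !scale1r scaler_nat mulr2n opprB addrC addrA subrK addrC.
rewrite linearZ linearD linearZ /= product_sq.
rewrite [RHS]scalerA [in RHS]mulrC -[RHS]scalerA [in RHS]scalerDr.
by rewrite scalerA aa scale1r addrC.
Qed.

(** The action of the a-eigenspace on the quotient of g by it is well defined:
    changing w inside the a-eigenspace changes [lie x w] inside it, because it
    is a subalgebra. *)
Lemma opp_proj_lie x w : E x = a *: x ->
  opp_proj (lie x (opp_proj w)) = opp_proj (lie x w).
Proof.
move=> Ex; apply/esym/eqP; rewrite -subr_eq0 -linearB -linearBr /=.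
by apply/eqP/opp_proj_eq0/eigen_lie => //; apply: eigen_sub_opp_proj.
Qed.

(** The Bott connection of the a-eigenspace h, carried from g / h to h by J. *)
Definition induced x y := - J (opp_proj (lie x (J y))).

Lemma eigen_induced x y : E (induced x y) = a *: induced x y.
Proof.
by rewrite linearN /= (eigenJ (eigen_opp_proj _)) opprK scalerN.
Qed.

Lemma J_induced x y : J (induced x y) = opp_proj (lie x (J y)).
Proof. by rewrite linearN /= complex_sq opprK. Qed.

Lemma induced_bilinear : bilinear_for *:%R *:%R induced.
Proof.
split=> u b x y; rewrite /induced; first rewrite linearPl.
  by rewrite (linearP opp_proj) (linearP J) /= opprD scalerN.
by rewrite (linearP J) linearPr (linearP opp_proj) (linearP J) /= opprD scalerN.
Qed.

(** By [opp_proj_lie] the inner projections can be dropped, and what remains is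
    the Jacobi identity. *)
Lemma induced_flat x y z : E x = a *: x -> E y = a *: y ->
  induced x (induced y z) - induced y (induced x z) = induced (lie x y) z.
Proof.
move=> Ex Ey; rewrite {1 3}/induced !J_induced !opp_proj_lie // -opprD.
by rewrite -!linearB -lie_lie.
Qed.

(** Integrability of J gives [x, J y] - [y, J x] = J [x, y] - J [J x, J y]. The
    first term is in the (-a)-eigenspace; the second is in the a-eigenspace, as
    J exchanges the two eigenspaces and both are subalgebras, so the projection
    removes it. *)
Lemma induced_torsion_free x y : E x = a *: x -> E y = a *: y ->
  induced x y - induced y x = lie x y.
Proof.
move=> Ex Ey.
have eJ : lie x (J y) - lie y (J x) = J (lie x y) - J (lie (J x) (J y)).
  by rewrite (lieC y) opprK complex_int addrK addrC.
have JJ0 : opp_proj (J (lie (J x) (J y))) = 0.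
  apply: opp_proj_eq0 => //; rewrite -[X in X *: _]opprK.
  by apply/eigenJ/eigen_lie; rewrite ?mulrNN //; apply: eigenJ.
rewrite /induced opprK addrC -opprB -!linearB eJ /= linearB /= JJ0 subr0.
rewrite opp_proj_id; last exact/eigenJ/eigen_lie.
by rewrite complex_sq opprK.
Qed.

End Eigenalgebra.

(** * The symplectic form on an eigenspace *)

Lemma nondegenerateP (K : fieldType) eps (theta : {rmorphism K -> K})
    (V : vectType K) (f : {hermitian V for eps & theta}) :
  reflect (forall u, (forall v, f u v = 0) -> u = 0) (nondegenerate f).
Proof.
rewrite /nondegenerate -subv0; apply: (iffP subvP) => [sub0 u fu0|inj u].
  by apply/eqP; rewrite -memv0; apply/sub0/mem_orthovP => v _; apply: fu0.
move=> /mem_orthovP fu0; rewrite memv0; apply/eqP/inj => v.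
exact/fu0/memvf.
Qed.

Section Form.
Variables (R : realType) (g : lieAlgebra R) (H : hypersymplecticStructure g).
Notation J := (cps_J H).
Notation E := (cps_E H).
Notation m := (hs_metric H).
Implicit Types (a b : R) (w x y z : g).

Lemma metricC x y : m x y = m y x.
Proof. by rewrite hermC expr0 mul1r. Qed.

Lemma metricJC x y : m (J x) y = - m (J y) x.
Proof. by rewrite -hs_compatJ complex_sq linearNl metricC. Qed.

Lemma metric_eigen a w z : a * a = 1 -> E z = a *: z ->
  a * m (E w) z = - m w z.
Proof.
by move=> aa Ez; rewrite -hs_compatE Ez linearZr_LR.
Qed.

Lemma eigen_isotropic a x y : a * a = 1 -> E x = a *: x -> E y = a *: y ->
  m x y = 0.
Proof.
move=> aa Ex Ey; have := metric_eigen x aa Ey.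
rewrite Ex linearZl_LR /= mulrA aa mul1r => /eqP.
by rewrite -addr_eq0 -mulr2n mulrn_eq0 => /eqP.
Qed.

Variables (a : R) (aa : a * a = 1).

(** The discarded component of w lies in the isotropic a-eigenspace with z. *)
Lemma metric_opp_proj w z : E z = a *: z -> m (opp_proj H a w) z = m w z.
Proof.
move=> Ez; rewrite opp_projE linearZl_LR linearBl /= linearZl_LR /=.
by rewrite metric_eigen // opprK; field.
Qed.

Lemma metric_induced x y z : E z = a *: z ->
  m (J (induced H a x y)) z = m (lie x (J y)) z.
Proof. by move=> Ez; rewrite J_induced metric_opp_proj. Qed.

(** With A x y z = omega (nabla_x y) z, closedness of omega_2 on (x, J y, z)
    says that A x y z - A x z y changes sign under a cyclic permutation of
    (x, y, z); since such a permutation has odd order, it vanishes. *)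
Lemma induced_parallel x y z : E x = a *: x -> E y = a *: y -> E z = a *: z ->
  m (J (induced H a x y)) z = m (J (induced H a x z)) y.
Proof.
pose A u v w := m (J (induced H a u v)) w.
have cocycle u v w : E u = a *: u -> E v = a *: v -> E w = a *: w ->
    (A u v w - A u w v) + (A w u v - A w v u) = 0.
  move=> Eu Ev Ew; have := congr1 ( *%R a) (hs_closed2 H u (J v) w).
  (* J v has eigenvalue - a, so this one of the three terms of omega_2 comes
     with the opposite sign. *)
  have EJv : - a * m (E (lie u w)) (J v) = - m (lie u w) (J v).
    by apply: metric_eigen; [rewrite mulrNN | apply: eigenJ].
  rewrite mulr0 mulrBr mulrDr mulrN (metric_eigen _ aa Ew).
  rewrite (metric_eigen _ aa Eu).
  rewrite (lieC (J v)) linearNl /= -!metric_induced //.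
  have -> : a * m (E (lie u w)) (J v) = m (lie u w) (J v) by lra.
  (* Vanishing of the torsion turns the bracket of two elements of the
     eigenspace into a difference of values of A. *)
  have -> : m (lie u w) (J v) = - (A u w v - A w u v).
    rewrite metricC metricJC -(induced_torsion_free aa Eu Ew).
    by rewrite (linearB J) linearBl.
  by rewrite -/(A u v w) -/(A w v u) => <-; ring.
move=> Ex Ey Ez; rewrite -/(A x y z) -/(A x z y).
have := cocycle x y z Ex Ey Ez; have := cocycle z x y Ez Ex Ey.
have := cocycle y z x Ey Ez Ex; lra.
Qed.

(** If J x is orthogonal to the a-eigenspace, it is orthogonal to everything,
    since it lies in the isotropic (-a)-eigenspace. *)
Lemma eigen_form_inj x : E x = a *: x ->
  (forall y, E y = a *: y -> m (J x) y = 0) -> x = 0.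
Proof.
move=> Ex mJx0; suff Jx0 : J x = 0.
  by apply: oppr_inj; rewrite oppr0 -(complex_sq (cps_J H)) Jx0 linear0.
apply: (elimT (nondegenerateP _) (hs_nondegenerate H)) => w.
rewrite -[w](subrK (opp_proj H a w)) linearDr /=.
rewrite mJx0 ?add0r; last exact: eigen_sub_opp_proj.
apply: (@eigen_isotropic (- a)); first by rewrite mulrNN.
  exact: eigenJ.
exact: eigen_opp_proj.
Qed.

Notation h := (algebra_of (eigenalgebra H aa)).

Lemma eigenvalP (x : h) : E (val x) = a *: val x.
Proof. exact/mem_eigenalgebra/subvsP. Qed.

Definition eigen_connection (x y : h) : h :=
  Subvs (introT (mem_eigenalgebra H aa _)
    (eigen_induced H aa (val x) (val y))).

Definition eigen_form (x y : h) : R := m (J (val x)) (val y).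

Fact eigen_connection_bilinear : bilinear_for *:%R *:%R eigen_connection.
Proof.
split=> u b x y; apply: val_inj => /=;
  by rewrite ?(induced_bilinear H a).1 ?(induced_bilinear H a).2.
Qed.

HB.instance Definition _ :=
  bilinear_isBilinear.Build R h h h _ _ eigen_connection
    eigen_connection_bilinear.

Fact eigen_form_bilinear : bilinear_for *%R *%R eigen_form.
Proof.
split=> u b x y; rewrite /eigen_form /=; first by rewrite linearP linearPl.
by rewrite linearPr.
Qed.

HB.instance Definition _ :=
  bilinear_isBilinear.Build R h h R _ _ eigen_form eigen_form_bilinear.

Fact eigen_form_skew (x y : h) :
  eigen_form x y = (-1) ^+ true * idfun (eigen_form y x).
Proof. by rewrite expr1 mulN1r /= [LHS]metricJC. Qed.

HB.instance Definition _ :=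
  isHermitianSesquilinear.Build R h true idfun eigen_form eigen_form_skew.

Lemma eigen_connection_flat : flat eigen_connection.
Proof. by move=> x y z; apply/val_inj/induced_flat/eigenvalP/eigenvalP. Qed.

Lemma eigen_connection_torsion_free : torsion_free eigen_connection.
Proof. by move=> x y; apply/val_inj/induced_torsion_free/eigenvalP/eigenvalP. Qed.

Lemma eigen_form_symplectic : symplectic eigen_form.
Proof.
split=> [|x y z]; last exact: (hs_closed1 H).
apply/nondegenerateP => u fu0; apply/val_inj/eigen_form_inj.
  exact: eigenvalP.
move=> y /(mem_eigenalgebra H aa) yh; exact: (fu0 (Subvs yh)).
Qed.

Lemma eigen_connection_parallel : parallel eigen_connection eigen_form.
Proof. by move=> x y z; apply: induced_parallel; apply: eigenvalP. Qed.

End Form.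

Theorem theorem3p4 (R : realType) (g : lieAlgebra R)
    (H : hypersymplecticStructure g) :
  let gplus := algebra_of (double_plus (associated_double H)) in
  let gminus := algebra_of (double_minus (associated_double H)) in
  exists (nabla_plus : connection gplus) (omega_plus : {skew_symmetric gplus})
         (nabla_minus : connection gminus)
         (omega_minus : {skew_symmetric gminus}),
    [/\ [/\ flat nabla_plus, torsion_free nabla_plus,
             symplectic omega_plus & parallel nabla_plus omega_plus],
        [/\ flat nabla_minus, torsion_free nabla_minus,
             symplectic omega_minus & parallel nabla_minus omega_minus]
      & forall x y : gplus,
          omega_plus x y = omega_minus (J_plus x) (J_plus y)].
Proof.
pose sq_1 : (1 : R) * 1 = 1 := mulr1 1.
pose sq_N1 : (- 1 : R) * - 1 = 1 := etrans (mulrNN 1 1) (mulr1 1).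
exists (@eigen_connection R g H 1 sq_1), (@eigen_form R g H 1 sq_1).
exists (@eigen_connection R g H (- 1) sq_N1), (@eigen_form R g H (- 1) sq_N1).
split; last by move=> x y; apply/esym/hs_compatJ.
  split; [exact: eigen_connection_flat | exact: eigen_connection_torsion_free
    | exact: eigen_form_symplectic | exact: eigen_connection_parallel].
split; [exact: eigen_connection_flat | exact: eigen_connection_torsion_free
  | exact: eigen_form_symplectic | exact: eigen_connection_parallel].
Qed.
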